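(* There is a continuous map $\varphi\colon I\to I^5$ which is $(7/8)$-prekolmogorov for every continuous function $f\colon I^2\to\mathbb{R}$.
   Context: Notation: $I:=[0,1]$. A map $\varphi\colon I\to I^5$ is identified with the ordered tuple of its components $\varphi_1,\ldots,\varphi_5\colon I\to I$. All functions and maps are assumed continuous. For a real-valued function $f$ on a compact set $M\subset\mathbb{R}^s$, $\|f\|:=\sup_{z\in M}|f(z)|$ (with $M$ the domain of the function in question). For a continuous function $h\colon[0,3]\to\mathbb{R}$ and a continuous map $\varphi\colon I\to I^5$, define $S_\varphi h\colon I^2\to\mathbb{R}$ by \[ S_\varphi h(x,y):=\sum_{k=1}^5 h\left(\varphi_k(x)+\sqrt{2}\,\varphi_k(y)\right). \] Definition: for a real number $\lambda$ and a continuous function $f\colon I^2\to\mathbb{R}$ that is not identically zero, a continuous map $\varphi\colon I\to I^5$ is called $\lambda$-prekolmogorov for $f$ if there exists a continuous function $h\colon[0,3]\to\mathbb{R}$ such that \[ \|f-S_\varphi h\|<\lambda\|f\|\quad\text{and}\quad \|h\|\leqslant\|f\|. \] For $f\equiv 0$, every continuous map $\varphi\colon I\to I^5$ is $\lambda$-prekolmogorov by definition. *)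

(* Defs.v *)
From HB Require Import structures.
From mathcomp Require Import all_boot all_order all_algebra.
From mathcomp Require Import all_classical all_reals all_analysis.

Set Implicit Arguments.
Unset Strict Implicit.
Unset Printing Implicit Defensive.

Import Order.TTheory GRing.Theory Num.Theory.
Import numFieldNormedType.Exports.

Local Open Scope classical_set_scope.
Local Open Scope ring_scope.

(* A map defined on a subset M of some ambient space is represented by a total
   function on the ambient space together with M. Its values outside M play no
   role: continuity is {within M, continuous _} and norms are taken over M. *)

Definition unitI (R : realType) : set R := [set` `[0, 1]].
Arguments unitI R : clear implicits.

Definition unitI2 (R : realType) : set (R * R) := unitI R `*` unitI R.
Arguments unitI2 R : clear implicits.

Definition unitI5 (R : realType) : set 'rV[R]_5 :=
  [set v | forall k : 'I_5, unitI R (v ord0 k)].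
Arguments unitI5 R : clear implicits.

Definition itv03 (R : realType) : set R := [set` `[0, 3]].
Arguments itv03 R : clear implicits.

(* [sup] is a junk value on unbounded or empty sets; here M is always nonempty
   and compact and f is always continuous on M. *)
Definition sup_norm (R : realType) (T : Type) (M : set T) (f : T -> R) : R :=
  sup [set `|f z| | z in M].

Definition continuous_I_I5 (R : realType) (phi : R -> 'rV[R]_5) : Prop :=
  {within unitI R, continuous phi} /\
  (forall x, unitI R x -> unitI5 R (phi x)).

Definition S_op (R : realType) (phi : R -> 'rV[R]_5) (h : R -> R)
    (z : R * R) : R :=
  \sum_(k < 5) h (phi z.1 ord0 k + Num.sqrt 2 * phi z.2 ord0 k).

Definition prekolmogorov (R : realType) (lambda : R) (f : R * R -> R)
    (phi : R -> 'rV[R]_5) : Prop :=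
  continuous_I_I5 phi /\
  (~ (forall z, unitI2 R z -> f z = 0) ->
   exists h : R -> R,
     [/\ {within itv03 R, continuous h},
         sup_norm (unitI2 R) (fun z => f z - S_op phi h z)
           < lambda * sup_norm (unitI2 R) f
       & sup_norm (itv03 R) h <= sup_norm (unitI2 R) f]).

(* Main.v *)
Require Import Defs.
From HB Require Import structures.
From mathcomp Require Import all_boot all_order all_algebra.
From mathcomp Require Import all_classical all_reals all_analysis.
From mathcomp Require Import ring lra zify.

Set Implicit Arguments.
Unset Strict Implicit.
Unset Printing Implicit Defensive.

Import Order.TTheory GRing.Theory Num.Theory.
Import numFieldNormedType.Exports.

Local Open Scope classical_set_scope.
Local Open Scope ring_scope.

(** At scale [N], cut the line into cells of length [4/(5N)] separated by gaps
    of length [1/(5N)], in five copies shifted by multiples of [1/(5N)]: a point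
    of the unit interval lies in a cell of at least four of the five copies.  If
    every [phi_k] is nearly constant on the cells of copy [k], with values
    [p k m] such that all the sums [p k i + sqrt 2 * p k j] are distinct, then
    some [h] with [|h| <= ||f||/5] takes nearly the value [f(x,y)/5] at
    [phi_k x + sqrt 2 * phi_k y] whenever [x] and [y] both lie in cells of
    copy [k].  This fails for at most two [k], and each failure costs at most
    [2||f||/5], so the error is at most [4/5] of [||f||] up to a small
    perturbation.  Maps that are constant on cells with such values (distinct
    rationals suffice) are uniformly dense, and the near-constancy survives
    small perturbations, so a nested sequence of balls shrinks to a map that
    works at arbitrarily fine scales, hence for every [f]. *)

(** * Sup norms, uniform continuity on compact sets, Lipschitz sums *)

Section CompactSup.
Variable R : realType.

Lemma normr_le_sup_norm (T : topologicalType) (K : set T) (f : T -> R) z :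
  compact K -> {within K, continuous f} -> K z -> `|f z| <= sup_norm K f.
Proof.
move=> cK cf Kz; apply: ub_le_sup; last by exists z.
have /compact_bounded [M [_ bM]] := continuous_compact cf cK.
by exists (M + 1) => _ [y Ky <-]; apply: (bM _ (ltr_pwDr ltr01 (lexx M))); exists y.
Qed.

Lemma sup_norm_le (T : Type) (K : set T) (f : T -> R) c :
  K !=set0 -> (forall z, K z -> `|f z| <= c) -> sup_norm K f <= c.
Proof.
move=> [z Kz] fc; apply: ge_sup; first by exists `|f z|; exists z.
by move=> _ [y Ky <-]; apply: fc.
Qed.

Lemma compact_within_unif_continuous (V : pseudoMetricType R) (K : set V)
    (f : V -> R) (e : R) :
  compact K -> {within K, continuous f} -> 0 < e ->
  exists2 d : R, 0 < d &
    forall z z', K z -> K z' -> ball z d z' -> `|f z - f z'| < e.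
Proof.
move=> /compact_near_coveringP cK cf e0.
(* Near-covering compactness, along radii [d] tending to 0 from the right, turns local radii into a
   common one. *)
have [] := cK R (0^'+) (fun d z =>
    forall z', K z' -> ball z d z' -> K z -> `|f z - f z'| < e).
  move=> z Kz.
  have /subspace_continuousP/(_ z Kz)/cvgrPdist_lt/(_ (e / 2)) := cf.
  rewrite divr_gt0// => /(_ isT); rewrite near_withinE => /nbhs_ballP[d /= d0 hd].
  exists (ball z (d / 2), [set x | x < d / 2]).
    split => /=; first by apply: nbhsx_ballx; rewrite divr_gt0.
    exact: nbhs_right_lt (divr_gt0 _ _).
  move=> [z1 x] /= [zz1 xd] z' Kz' z1z' Kz1.
  have h1 : `|f z - f z1| < e / 2.
    by apply: hd => //; apply: le_ball zz1; lra.
  have h2 : `|f z - f z'| < e / 2.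
    apply: hd => //; rewrite (_ : d = d / 2 + d / 2); last by lra.
    by apply: ball_triangle zz1 _; apply: le_ball z1z'; apply: ltW.
  by rewrite distrC in h1; rewrite (le_lt_trans (ler_distD (f z) _ _))//; lra.
move=> d /= d0 hd; exists (d / 2); first by lra.
move=> z z' Kz Kz' bz; apply: (hd (d / 2)) => //=; last by lra.
rewrite sub0r normrN gtr0_norm; lra.
Qed.

Lemma continuous_lipschitz (g : R -> R) L :
  (forall x y, `|g x - g y| <= L * `|x - y|) -> continuous g.
Proof.
move=> gL x; apply/cvgrPdist_le => e e0.
have L1 : 0 < `|L| + 1 by rewrite ltr_wpDl.
near=> y.
apply: le_trans (gL _ _) _.
apply: (@le_trans _ _ ((`|L| + 1) * `|x - y|)).
  by rewrite ler_wpM2r// (le_trans (ler_norm L))// lerDl.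
rewrite mulrC -ler_pdivlMr//; near: y.
by apply: cvgr_dist_le => //; rewrite divr_gt0.
Unshelve. all: by end_near. Qed.

Lemma sum_lipschitz (T : finType) (v : T -> R) (g : T -> R -> R) (C L x y : R) :
  (forall u, `|v u| <= C) ->
  (forall u s t, `|g u s - g u t| <= L * `|s - t|) ->
  `|\sum_u v u * g u x - \sum_u v u * g u y| <= (#|T|%:R * (C * L)) * `|x - y|.
Proof.
move=> vC gL; rewrite -sumrB; apply: le_trans (ler_norm_sum _ _ _) _.
rewrite -mulrA mulr_natl -sumr_const; apply: ler_sum => u _.
by rewrite -mulrBr normrM -mulrA ler_pM.
Qed.

End CompactSup.

(** * Truncation to the unit interval and a trapezoidal partition of unity *)

Section Clamp.
Variable R : realType.
Implicit Types x y : R.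

Definition clamp01 x : R := Num.max 0 (Num.min 1 x).

Lemma clamp01P x : [\/ clamp01 x = 0 /\ x <= 0,
  clamp01 x = x /\ 0 <= x <= 1 | clamp01 x = 1 /\ 1 <= x].
Proof.
rewrite /clamp01; have [x1|x1] := leP 1 x.
  by rewrite max_r ?ler01//; apply: Or33.
have [x0|x0] := leP 0 x; first by apply: Or32; rewrite ltW.
by apply: Or31; rewrite ltW.
Qed.

Lemma clamp01_bounds x : 0 <= clamp01 x <= 1.
Proof. by case: (clamp01P x) => -[-> ?]; lra. Qed.

Lemma clamp01_id x : 0 <= x <= 1 -> clamp01 x = x.
Proof. by case: (clamp01P x) => -[-> ?]; lra. Qed.

Lemma clamp01_eq0 x : x <= 0 -> clamp01 x = 0.
Proof. by case: (clamp01P x) => -[-> ?]; lra. Qed.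

Lemma clamp01_eq1 x : 1 <= x -> clamp01 x = 1.
Proof. by case: (clamp01P x) => -[-> ?]; lra. Qed.

Lemma le_clamp01 x y : x <= y -> clamp01 x <= clamp01 y.
Proof.
by case: (clamp01P x) => -[-> ?]; case: (clamp01P y) => -[-> ?]; lra.
Qed.

Lemma clamp01_lipschitz x y : `|clamp01 x - clamp01 y| <= `|x - y|.
Proof.
wlog xy : x y / x <= y => [H|].
  by case: (leP x y) => [/H//|/ltW/H]; rewrite distrC (distrC x).
rewrite ler0_norm ?subr_le0 ?le_clamp01// ler0_norm ?subr_le0//.
by case: (clamp01P x) => -[-> ?]; case: (clamp01P y) => -[-> ?]; lra.
Qed.

(** A trapezoid: 1 on [[0, 4/5]], a cell in rescaled coordinates, with ramps of width 1/5 over the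
    two adjacent gaps. *)
Definition tooth x : R := clamp01 (5 * x + 1) - clamp01 (5 * x - 4).

Lemma tooth_ge0 x : 0 <= tooth x.
Proof. by rewrite subr_ge0 le_clamp01//; lra. Qed.

Lemma tooth_eq1 x : 0 <= x <= 4 / 5 -> tooth x = 1.
Proof.
by move=> ?; rewrite /tooth clamp01_eq1 1?clamp01_eq0 ?subr0//; lra.
Qed.

Lemma tooth_eq0 x : (x <= - (1 / 5)) || (1 <= x) -> tooth x = 0.
Proof.
rewrite /tooth => /orP[] ?.
  by rewrite !clamp01_eq0 ?subrr//; lra.
by rewrite !clamp01_eq1 ?subrr//; lra.
Qed.

Lemma tooth_lipschitz x y : `|tooth x - tooth y| <= 10 * `|x - y|.
Proof.
have -> : tooth x - tooth y = (clamp01 (5 * x + 1) - clamp01 (5 * y + 1)) -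
   (clamp01 (5 * x - 4) - clamp01 (5 * y - 4)) by rewrite /tooth; ring.
apply: le_trans (ler_normB _ _) _.
have := clamp01_lipschitz (5 * x + 1) (5 * y + 1).
have := clamp01_lipschitz (5 * x - 4) (5 * y - 4).
rewrite (_ : _ - 4 - _ = 5 * (x - y)); last by ring.
rewrite (_ : _ + 1 - _ = 5 * (x - y)); last by ring.
by rewrite normrM ger0_norm//; lra.
Qed.

(** The falling ramp of one tooth is the rising ramp of the next, so the sum telescopes; the range
    of [x] puts the two end terms at 1 and 0. *)
Lemma sum_tooth N x : 0 <= x <= N%:R + 4 / 5 ->
  \sum_(m < N.+1) tooth (x - m%:R) = 1.
Proof.
move=> xN.
rewrite -(big_mkord xpredT (fun m => tooth (x - m%:R))).
rewrite (eq_bigr (fun m : nat => - clamp01 (5 * (x - m.+1%:R) + 1) -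
    - clamp01 (5 * (x - m%:R) + 1))); last first.
  move=> m _; rewrite /tooth -natr1 opprK addrC; congr (- clamp01 _ + _); ring.
rewrite telescope_sumr// clamp01_eq0; last by rewrite -natr1; lra.
by rewrite clamp01_eq1; lra.
Qed.

End Clamp.

(** * Perturbation to values with distinct sums, by irrationality of [sqrt 2] *)

Section Distinct.
Variable R : realType.

(** For nonzero [b], the exponent of 2 is even in [a ^ 2] and odd in [2 * b ^ 2]. *)
Lemma sqr_double_sqr_eq0 (a b : nat) : (a ^ 2 = 2 * b ^ 2)%N -> b = 0%N.
Proof.
move=> ab; apply/eqP; rewrite -leqn0 leqNgt; apply/negP => b0.
have a0 : (0 < a)%N by rewrite lt0n; apply/eqP => a0; move: ab; rewrite a0; lia.
have := congr1 (logn 2) ab.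
by rewrite lognM ?expn_gt0 ?b0// !lognX (@logn_prime 2 2)//; lia.
Qed.

Lemma natr_sqrt2_inj (a b a' b' : nat) :
  a%:R + Num.sqrt 2 * b%:R = a'%:R + Num.sqrt 2 * b'%:R :> R ->
  a = a' /\ b = b'.
Proof.
wlog bb' : a b a' b' / (b <= b')%N => [H|] E.
  by case/orP: (leq_total b b') => bb'; [|case: (H a' b' a b bb')]; auto.
suff bE : b = b'.
  by split=> //; apply/eqP; rewrite -(@eqr_nat R); move: E; rewrite bE => /addIr ->.
apply/eqP; rewrite eqn_leq bb' -subn_eq0; apply/eqP.
(* With truncated subtraction this sum is the absolute difference of [a] and [a']. *)
apply: (@sqr_double_sqr_eq0 ((a - a') + (a' - a))).
apply/eqP; rewrite -(@eqr_nat R) natrM !natrX.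
have -> : ((a - a' + (a' - a))%:R : R) ^+ 2 = (a%:R - a'%:R) ^+ 2.
  case/orP: (leq_total a a') => h; rewrite natrD (eqP h).
    by rewrite add0r natrB// -sqrrN opprB.
  by rewrite addr0 natrB.
have -> : (a%:R : R) - a'%:R = Num.sqrt 2 * (b' - b)%:R.
  by rewrite natrB// mulrBr; lra.
by rewrite exprMn sqr_sqrtr.
Qed.

(** For rounding [q] to [(a + k) / (m + 1)]: taking [a] as the floor of [m * q], not of
    [(m + 1) * q], leaves room for the tag [k] below 1. *)
Lemma floor_add_bounds (m k a q : R) :
  0 <= m -> 0 <= k <= 1 -> a <= m * q < a + 1 -> 0 <= q <= 1 ->
  a + k <= m + 1 /\ `|a + k - q * (m + 1)| <= 2.
Proof.
move=> m0 k01 aq q01; have mq : m * q <= m by nra.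
by split; [lra|rewrite ler_norml; lra].
Qed.

(* The approximants are rationals with a common denominator whose numerators are
   distinct modulo #|T|; irrationality of sqrt 2 separates the pairs. *)
Lemma sqrt2_independent_approx (T : finType) (q : T -> R) (e : R) :
  (forall t, 0 <= q t <= 1) -> 0 < e ->
  exists p : T -> R, [/\ forall t, 0 <= p t <= 1,
    forall t, `|p t - q t| <= e
    & forall t u t' u', p t + Num.sqrt 2 * p u = p t' + Num.sqrt 2 * p u' ->
      t = t' /\ u = u'].
Proof.
move=> q01 e0.
(* Rounding moves each value by at most [2 / (M + 1)], which is below [e] for this [M]. *)
pose M := Num.truncn (2 / e); pose K := #|T|.
have Me : 2 / e < M.+1%:R by exact: truncnS_gt.
pose a t := Num.truncn (M%:R * q t).
pose c t := (a t * K + enum_rank t)%N.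
have cinj : injective c.
  move=> t t' /(congr1 (modn^~ K)); rewrite /c !modnMDl !modn_small//.
  by move=> E; apply: enum_rank_inj; apply: val_inj.
pose D : R := M.+1%:R * K%:R.
have K0 (t : T) : 0 < K%:R :> R by rewrite ltr0n; apply/card_gt0P; exists t.
have M0 : 0 < M.+1%:R :> R by rewrite ltr0n.
have D0 (t : T) : 0 < D by rewrite mulr_gt0// (K0 t).
exists (fun t => (c t)%:R / D).
have cE t : (c t)%:R = (a t)%:R * K%:R + (enum_rank t)%:R :> R.
  by rewrite natrD natrM.
have rk (t : T) : 0 <= (enum_rank t)%:R / (K%:R : R) <= 1.
  rewrite divr_ge0//= (ler_pdivrMr _ _ (K0 t)) mul1r ler_nat ltnW//.
have aq t : (a t)%:R <= M%:R * q t < (a t)%:R + 1.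
  by rewrite natr1; apply: truncn_itv; rewrite mulr_ge0//; case/andP: (q01 t).
have E t : (c t)%:R / D * M.+1%:R = (a t)%:R + (enum_rank t)%:R / K%:R.
  by have := K0 t; rewrite cE /D => k0; field; rewrite !gt_eqF.
have MS : M.+1%:R = M%:R + 1 :> R by rewrite natr1.
have Mge : 0 <= M%:R :> R by rewrite ler0n.
split.
- move=> t; rewrite divr_ge0 ?ler0n ?(ltW (D0 t))//= -(ler_pM2r M0) E mul1r MS.
  exact: (floor_add_bounds Mge (rk t) (aq t) (q01 t)).1.
- move=> t; rewrite -(ler_pM2r M0) -{1}(gtr0_norm M0) -normrM mulrBl E.
  have e2 : 2 <= e * M.+1%:R by rewrite mulrC -ler_pdivrMr//; exact: ltW.
  apply: le_trans e2; rewrite MS.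
  exact: (floor_add_bounds Mge (rk t) (aq t) (q01 t)).2.
- move=> t u t' u' /(congr1 (fun z => z * D)).
  rewrite !mulrDl -!mulrA !mulVf ?gt_eqF ?(D0 t)// !mulr1 => /natr_sqrt2_inj[].
  by move=> /cinj-> /cinj->.
Qed.

Lemma finite_separation (T : finType) (s : T -> R) : injective s ->
  exists2 d : R, 0 < d & forall u v, u != v -> d <= `|s u - s v|.
Proof.
move=> sinj.
(* The default 1 keeps the minimum positive when there is no pair of distinct points. *)
exists (\big[Num.min/1]_(w : T * T | w.1 != w.2) `|s w.1 - s w.2|).
  apply: lt_bigmin => // -[u v] /= uv; rewrite normr_gt0 subr_eq0.
  by apply: contra uv => /eqP/sinj->.
by move=> u v uv; apply: (bigmin_le_cond _ (j := (u, v))).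
Qed.

End Distinct.

(** * Cells and the construction of the outer function [h] *)

Section Superposition.
Variable R : realType.
Implicit Types (r x y : R) (chi psi : 'I_5 -> R -> R).

(** For [N > 0], the interval of length [4/(5N)] with left end [(m - k/5)/N]. *)
Definition cell (N k m : nat) x := 0 <= N%:R * x + k%:R / 5 - m%:R <= 4 / 5.

(* In units of 1/(5N), shifting by k cyclically permutes the five residue
   classes, and only the residue 4 falls in a gap. *)
Lemma cell_cover N x : 0 <= x <= 1 ->
  exists q : nat, forall k : 'I_5, ((q + k) %% 5 != 4)%N ->
    exists m : 'I_N.+1, cell N k m x.
Proof.
move=> x01; pose q := Num.truncn (5 * N%:R * x).
have N0 : 0 <= N%:R :> R by rewrite ler0n.
have q5 : q%:R <= 5 * N%:R * x < q%:R + 1.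
  by rewrite natr1; apply: truncn_itv; nra.
exists q => k qk.
have qN : (q <= 5 * N)%N by rewrite -(ler_nat R) natrM; nra.
have mN : ((q + k) %/ 5 < N.+1)%N.
  by have := ltn_ord k; have := divn_eq (q + k) 5; lia.
exists (Ordinal mN); rewrite /cell /=.
have := congr1 (fun n : nat => n%:R : R) (divn_eq (q + k) 5).
(* A residue [s <= 3] puts [N x + k/5 - m] between [s/5] and [(s+1)/5], hence in the cell. *)
have : (((q + k) %% 5)%N%:R : R) <= 3.
  by rewrite (ler_nat R _ 3); have := ltn_pmod (q + k) (isT : (0 < 5)%N); lia.
have : 0 <= (((q + k) %% 5)%N%:R : R) by rewrite ler0n.
rewrite natrD natrD natrM; lra.
Qed.

(** Five consecutive integers meet each residue class once, so a point misses at most one copy; [x]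
    and [y] together spoil at most two. *)
Lemma sum_residue_eq4 (q : nat) :
  \sum_(k < 5) ((q + k) %% 5 == 4)%N%:R = 1 :> R.
Proof.
under eq_bigr do rewrite -modnDml.
have := ltn_pmod q (isT : (0 < 5)%N).
by case: (q %% 5)%N => [|[|[|[|[|//]]]]] _;
  rewrite !big_ord_recr big_ord0 /= ?(addr0, add0r).
Qed.

(** With [u = (k, i, j)], the target value of [phi_k x + sqrt 2 * phi_k y] for [x] in cell [i] and
    [y] in cell [j] of copy [k]. *)
Definition node N (p : 'I_5 -> 'I_N.+1 -> R) (u : 'I_5 * 'I_N.+1 * 'I_N.+1) :=
  p u.1.1 u.1.2 + Num.sqrt 2 * p u.1.1 u.2.

(* The factor 8 leaves room for bumps of half-width [4 r] around the nodes,
   constant within [3 r >= (1 + sqrt 2) r]. *)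
Definition separating N r chi :=
  exists p : 'I_5 -> 'I_N.+1 -> R,
    (forall (k : 'I_5) (m : 'I_N.+1) x, 0 <= x <= 1 -> cell N k m x ->
      `|chi k x - p k m| <= r) /\
    (forall u v, u != v -> 8 * r <= `|node p u - node p v|).

Lemma sqrt2_bounds : 0 <= Num.sqrt (2 : R) <= 2.
Proof.
rewrite sqrtr_ge0/= -[leRHS]ger0_norm// -sqrtr_sqr ler_wsqrtr//.
by rewrite expr2; lra.
Qed.

(** The clamp, needed because a cell may start below 0, is 1-Lipschitz and fixes [x]. The tolerance
    1 covers the support of a tooth as well as a cell. *)
Lemma cell_clamp N k m x : (0 < N)%N -> 0 <= x <= 1 ->
  `|N%:R * x + k%:R / 5 - m%:R| <= 1 ->
  `|x - clamp01 ((m%:R - k%:R / 5) / N%:R)| <= N%:R^-1.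
Proof.
move=> N0 x01 cx; rewrite -{1}(clamp01_id x01).
apply: le_trans (clamp01_lipschitz _ _) _.
have N0' : 0 < N%:R :> R by rewrite ltr0n.
rewrite -(ler_pM2r N0') -[X in `|_| * X](gtr0_norm N0') -normrM mulVf ?gt_eqF//.
rewrite mulrBl -mulrA mulVf ?gt_eqF// mulr1 mulrC.
by rewrite (_ : _ - _ = N%:R * x + k%:R / 5 - m%:R)//; ring.
Qed.

(** Each copy costs [M / 100] by oscillation of [f], and the at most two failing copies are charged
    [2 / 5 * M] more each; the total factor 17/20 stays below 7/8. *)
Lemma superposition_approx N r chi (f : R * R -> R) (M : R) :
  (0 < N)%N -> 0 < r -> separating N r chi ->
  (forall x y, 0 <= x <= 1 -> 0 <= y <= 1 -> `|f (x, y)| <= M) ->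
  (forall x y x' y', 0 <= x <= 1 -> 0 <= y <= 1 -> 0 <= x' <= 1 -> 0 <= y' <= 1 ->
    `|x - x'| <= N%:R^-1 -> `|y - y'| <= N%:R^-1 ->
    `|f (x, y) - f (x', y')| <= M / 20) ->
  exists h : R -> R, [/\ continuous h, forall s, `|h s| <= M / 5 &
    forall x y, 0 <= x <= 1 -> 0 <= y <= 1 ->
      `|f (x, y) - \sum_(k < 5) h (chi k x + Num.sqrt 2 * chi k y)| <= 17 / 20 * M].
Proof.
move=> N0 r0 [p [chip sep]] fM fN.
have M0 : 0 <= M by apply: le_trans (fM 0 0 _ _); rewrite ?lexx ?ler01.
pose c (k m : nat) : R := clamp01 ((m%:R - k%:R / 5) / N%:R).
pose v (u : 'I_5 * 'I_N.+1 * 'I_N.+1) := f (c u.1.1 u.1.2, c u.1.1 u.2) / 5.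
pose bump (s : R) : R := clamp01 (4 - `|s| / r).
have bump1 s : `|s| <= 3 * r -> bump s = 1.
  by move=> s3; apply: clamp01_eq1; rewrite -ler_pdivrMr// in s3; lra.
have bump0 s : 4 * r <= `|s| -> bump s = 0.
  by move=> s3; apply: clamp01_eq0; rewrite -ler_pdivlMr// in s3; lra.
pose h s := \sum_u v u * bump (s - node p u).
have v5 u : `|v u| <= M / 5.
  by rewrite normrM (@ger0_norm _ 5^-1) ?ler_wpM2r ?fM ?clamp01_bounds.
(* Nodes are [8 * r] apart, so a point within [4 * r] of one node meets no other bump; hence [h] is
   everywhere a single term or 0. *)
have hE s u : `|s - node p u| < 4 * r -> h s = v u * bump (s - node p u).
  move=> su; rewrite /h (bigD1 u)//= big1 ?addr0// => w wu.
  rewrite bump0 ?mulr0//; have := sep _ _ wu.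
  have := ler_distD s (node p w) (node p u); rewrite (distrC _ s); lra.
have h5 s : `|h s| <= M / 5.
  have [[u su]|su] := pselect (exists u, `|s - node p u| < 4 * r).
    rewrite (hE _ _ su) normrM -[leRHS]mulr1 ler_pM// ger0_norm;
      by case/andP: (clamp01_bounds (4 - `|s - node p u| / r)).
  rewrite /h big1 ?normr0 ?divr_ge0// => u _; rewrite bump0 ?mulr0// leNgt.
  by apply/negP => ?; apply: su; exists u.
exists h; split=> //.
  apply: continuous_lipschitz => s s'.
  apply: (sum_lipschitz (g := fun u s => bump (s - node p u)) (L := r^-1) s s' v5).
  move=> u s1 s2; apply: le_trans (clamp01_lipschitz _ _) _.
  rewrite (_ : _ - _ = r^-1 * (`|s2 - node p u| - `|s1 - node p u|)); last by ring.
  rewrite normrM gtr0_norm ?invr_gt0// ler_wpM2l ?invr_ge0 ?(ltW r0)//.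
  apply: le_trans (ler_dist_dist _ _) _.
  by rewrite (_ : _ - _ = s2 - s1) 1?distrC//; ring.
move=> x y x01 y01.
have [a ha] := cell_cover N x01; have [b hb] := cell_cover N y01.
have S5 : f (x, y) = \sum_(k < 5) f (x, y) / 5.
  by rewrite sumr_const card_ord -mulr_natl; field.
rewrite {1}S5 -sumrB; apply: le_trans (ler_norm_sum _ _ _) _.
pose bad (q k : nat) : R := ((q + k) %% 5 == 4)%N%:R.
suff bd (k : 'I_5) : `|f (x, y) / 5 - h (chi k x + Num.sqrt 2 * chi k y)| <=
    M / 100 + 2 / 5 * M * (bad a k) + 2 / 5 * M * (bad b k).
  apply: le_trans (ler_sum _ (fun k _ => bd k)) _.
  rewrite !big_split/= -!mulr_sumr /bad !sum_residue_eq4.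
  rewrite sumr_const card_ord -mulr_natl; lra.
have bad0 q j : 0 <= bad q j by rewrite ler0n.
have gen : `|f (x, y) / 5 - h (chi k x + Num.sqrt 2 * chi k y)| <= 2 / 5 * M.
  have := h5 (chi k x + Num.sqrt 2 * chi k y); have := fM x y x01 y01.
  have := ler_normB (f (x, y) / 5) (h (chi k x + Num.sqrt 2 * chi k y)).
  rewrite normrM (@ger0_norm _ 5^-1)//; lra.
have [ak|ak] := eqVneq ((a + k) %% 5)%N 4%N.
  have := bad0 b k; rewrite (_ : bad a k = 1); [nra|by rewrite /bad ak].
have [bk|bk] := eqVneq ((b + k) %% 5)%N 4%N.
  have := bad0 a k; rewrite (_ : bad b k = 1); [nra|by rewrite /bad bk].
rewrite /bad (negbTE ak) (negbTE bk) !mulr0 !addr0.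
have [i hi] := ha k ak; have [j hj] := hb k bk.
have cell1 z (m : nat) : cell N k m z -> `|N%:R * z + k%:R / 5 - m%:R| <= 1.
  by rewrite /cell ler_norml; lra.
have hs : `|chi k x + Num.sqrt 2 * chi k y - node p (k, i, j)| <= 3 * r.
  have -> : chi k x + Num.sqrt 2 * chi k y - node p (k, i, j) =
     (chi k x - p k i) + Num.sqrt 2 * (chi k y - p k j) by rewrite /node /=; ring.
  have /andP[s0 s2] := sqrt2_bounds.
  apply: le_trans (ler_normD _ _) _; rewrite normrM (ger0_norm s0).
  have := chip k i x x01 hi; have := chip k j y y01 hj.
  have := normr_ge0 (chi k y - p k j); nra.
rewrite (hE _ (k, i, j)) ?bump1//; last by apply: le_lt_trans hs _; lra.
rewrite mulr1 /v /= -mulrBl normrM (@ger0_norm _ 5^-1)//.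
have := fN x y (c k i) (c k j) x01 y01 (clamp01_bounds _) (clamp01_bounds _)
  (cell_clamp N0 x01 (cell1 _ _ hi)) (cell_clamp N0 y01 (cell1 _ _ hj)); lra.
Qed.

End Superposition.

(** * Dense approximation and the limit of nested balls *)

Section Construction.
Variable R : realType.
Implicit Types (r x y : R) (chi psi : 'I_5 -> R -> R).

Definition unit_valued psi := forall k x, 0 <= x <= 1 -> 0 <= psi k x <= 1.

Definition equi_lipschitz psi :=
  exists L : R, forall k x y, `|psi k x - psi k y| <= L * `|x - y|.

Definition close r psi chi :=
  forall k x, 0 <= x <= 1 -> `|chi k x - psi k x| <= r.

Lemma node_inj N (q : 'I_5 * 'I_N.+1 -> R) :
  (forall t u t' u', q t + Num.sqrt 2 * q u = q t' + Num.sqrt 2 * q u' ->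
      t = t' /\ u = u') ->
  injective (node (fun k m => q (k, m))).
Proof. by move=> qinj [[k i] j] [[k' i'] j'] /qinj[[-> ->]] /(congr1 snd) /= ->. Qed.

(** Sampling [psi] once per cell, moving the samples to separate the nodes and interpolating by
    teeth gives a map constant on cells. The added [r] in the estimate puts the [r]-ball about
    [psi'] inside the [e]-ball about [psi]. *)
Lemma separating_dense (n : nat) psi (e : R) :
  unit_valued psi -> equi_lipschitz psi -> 0 < e ->
  exists N psi' r, [/\ (n < N)%N, 0 < r, unit_valued psi' & equi_lipschitz psi'] /\
    (forall k x, 0 <= x <= 1 -> `|psi' k x - psi k x| + r <= e) /\
    (forall chi, close r psi' chi -> separating N r chi).
Proof.
move=> psi01 [L psiL] e0.
(* The summand [n] gives [n < N]; the other keeps the variation of [psi] over a length [1 / N]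
   within [e / 4]. *)
pose N := (n + Num.truncn (4 * `|L| / e)).+1.
have N0 : 0 < N%:R :> R by rewrite ltr0n.
have LN : `|L| * N%:R^-1 <= e / 4.
  rewrite ler_pdivrMr//.
  have : 4 * `|L| / e < N%:R.
    by apply: lt_le_trans (truncnS_gt _) _; rewrite ler_nat ltnS leq_addl.
  by rewrite ltr_pdivrMr//; lra.
pose c (k m : nat) : R := clamp01 ((m%:R - k%:R / 5) / N%:R).
have [//||q [q01 qpsi qinj]] :=
    @sqrt2_independent_approx R _ (fun t : 'I_5 * 'I_N.+1 => psi t.1 (c t.1 t.2)) (e / 4).
- by move=> t; apply: psi01; apply: clamp01_bounds.
- by rewrite divr_gt0.
pose p k m := q (k, m).
have [d d0 dsep] := finite_separation (node_inj qinj).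
(* Half of [e] is left for the distance from [psi] to [psi']; [d / 8] meets the separation bound. *)
pose r := Num.min (e / 2) (d / 8).
pose psi' (k : 'I_5) x :=
  \sum_(m < N.+1) p k m * tooth (N%:R * x + k%:R / 5 - m%:R).
have r0 : 0 < r by rewrite lt_min !divr_gt0.
have k5 (k : 'I_5) : 0 <= (k%:R / 5 : R) <= 4 / 5.
  rewrite divr_ge0//= ler_pM2r ?invr_gt0//.
  by rewrite (ler_nat R _ 4) -ltnS.
have sum1 (k : 'I_5) x : 0 <= x <= 1 ->
    \sum_(m < N.+1) tooth (N%:R * x + k%:R / 5 - m%:R) = 1.
  move=> x01; apply: sum_tooth; have := k5 k; nra.
exists N, psi', r; split; [split=> //|split].
- by rewrite ltnS leq_addr.
- move=> k x x01; apply/andP; split.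
    apply: sumr_ge0 => m _; rewrite mulr_ge0 ?tooth_ge0//.
    by case/andP: (q01 (k, m)).
  rewrite -(sum1 k x x01); apply: ler_sum => m _.
  by rewrite ler_piMl ?tooth_ge0//; case/andP: (q01 (k, m)).
- exists (#|'I_N.+1|%:R * (1 * (10 * N%:R))) => k x y.
  apply: (sum_lipschitz (v := p k) (g := fun (m : 'I_N.+1) x =>
    tooth (N%:R * x + k%:R / 5 - m%:R))).
    by move=> m; case/andP: (q01 (k, m)) => ? ?; rewrite ger0_norm.
  move=> m s t; apply: le_trans (tooth_lipschitz _ _) _.
  rewrite -mulrA ler_pM2l// -[X in _ <= X * _](gtr0_norm N0) -normrM.
  by rewrite (_ : _ - _ = N%:R * (s - t))//; ring.
- move=> k x x01.
  have re : r <= e / 2 by rewrite ge_min lexx.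
  suff : `|psi' k x - psi k x| <= e / 2 by lra.
  have avg (z : R) : z = \sum_(m < N.+1) z * tooth (N%:R * x + k%:R / 5 - m%:R).
    by rewrite -mulr_sumr sum1// mulr1.
  rewrite [psi k x]avg [leRHS]avg -sumrB; apply: le_trans (ler_norm_sum _ _ _) _.
  apply: ler_sum => m _; rewrite -mulrBl normrM (ger0_norm (tooth_ge0 _)).
  set u := _ - m%:R; have [u1|u1] := leP 1 `|u|.
    by rewrite tooth_eq0 ?mulr0//; move: u1; rewrite ler_normr => /orP[] ?;
      apply/orP; [right|left]; lra.
  rewrite ler_wpM2r ?tooth_ge0//.
  apply: le_trans (ler_distD (psi k (c k m)) _ _) _.
  have xc := cell_clamp (isT : (0 < N)%N) x01 (ltW u1).
  apply: (@le_trans _ _ (e / 4 + e / 4)); last by lra.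
  apply: lerD; first exact: qpsi (k, m).
  rewrite distrC; apply: le_trans (psiL _ _ _) _.
  apply: le_trans (ler_wpM2r (normr_ge0 _) (ler_norm L)) _.
  by apply: le_trans LN; rewrite ler_wpM2l.
- move=> chi chic; exists p; split.
    move=> k m x x01 kmx; suff <- : psi' k x = p k m by apply: chic.
    (* On cell [m] the argument of every other tooth is at least 1 or at most [-1/5], so only tooth
       [m] survives. *)
    rewrite /psi' (bigD1 m)//= (tooth_eq1 kmx) mulr1 big1 ?addr0// => j jm.
    rewrite tooth_eq0 ?mulr0//.
    move: kmx; rewrite /cell; have := jm; rewrite neq_ltn => /orP[];
      rewrite -(ler_nat R) -natr1.
      by move=> ? ?; apply/orP; right; lra.
    by move=> ? ?; apply/orP; left; lra.
  move=> u v uv; apply: le_trans (dsep u v uv).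
  by rewrite mulrC -ler_pdivlMr// ge_min lexx orbT.
Qed.

(** No left end [a n - r n] exceeds any right end, so the supremum of the left ends lies in every
    interval. *)
Lemma nested_balls_limit (a r : nat -> R) :
  (forall n, 0 <= r n) -> (forall n, `|a n.+1 - a n| + r n.+1 <= r n) ->
  exists l, forall n, `|l - a n| <= r n.
Proof.
move=> r0 ar.
have nest n j : `|a (n + j)%N - a n| + r (n + j)%N <= r n.
  elim: j => [|j IH]; first by rewrite addn0 subrr normr0 add0r.
  rewrite addnS; have := ar (n + j)%N.
  have := ler_distD (a (n + j)%N) (a (n + j).+1) (a n); lra.
have cross m n : a m - r m <= a n + r n.
  case/orP: (leq_total m n) => /subnKC <-.
    have := nest m (n - m)%N; have := r0 (m + (n - m))%N.
    have := ler_norm (- (a (m + (n - m))%N - a m)); rewrite normrN; lra.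
  have := nest n (m - n)%N; have := r0 (n + (m - n))%N.
  have := ler_norm (a (n + (m - n))%N - a n); lra.
exists (sup [set a n - r n | n in setT]) => n.
have ub : has_ubound [set a n - r n | n in setT].
  by exists (a 0%N + r 0%N) => _ [m _ <-].
have h1 : a n - r n <= sup [set a n - r n | n in setT].
  by apply: ub_le_sup => //; exists n.
have h2 : sup [set a n - r n | n in setT] <= a n + r n.
  by apply: ge_sup; [exists (a 0%N - r 0%N); exists 0%N|move=> _ [m _ <-]].
by rewrite ler_norml; lra.
Qed.

(** The limit lies in every ball of the sequence, so it inherits the separation of each stage; as
    the radii tend to 0, it is a uniform limit of Lipschitz maps, hence uniformly continuous. *)
Lemma universal_inner_maps :
  exists chi, [/\ unit_valued chi,
    (forall e, 0 < e -> exists2 d, 0 < d & forall k x y, 0 <= x <= 1 -> 0 <= y <= 1 ->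
      `|x - y| <= d -> `|chi k x - chi k y| <= e) &
    forall n, exists N r, [/\ (n < N)%N, 0 < r & separating N r chi]].
Proof.
pose S := (('I_5 -> R -> R) * R)%type.
pose admissible (s : S) := [/\ unit_valued s.1, equi_lipschitz s.1 & 0 < s.2].
pose refines n (s s' : S) := [/\ admissible s', s'.2 <= n.+1%:R^-1,
  (forall k x, 0 <= x <= 1 -> `|s'.1 k x - s.1 k x| + s'.2 <= s.2) &
  exists N, (n < N)%N /\ forall chi, close s'.2 s'.1 chi -> separating N s'.2 chi].
have /choice[F HF] : forall ns : nat * S, exists s',
    admissible ns.2 -> refines ns.1 ns.2 s'.
  move=> [n s]; have [as_|] := pselect (admissible s); last by exists s.
  case: (as_) => s01 sL s0.
  have e0 : 0 < Num.min s.2 n.+1%:R^-1 by rewrite lt_min s0 invr_gt0 ltr0n.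
  have [N [psi [r [[nN r0 p01 pL] [close_s sep]]]]] := separating_dense n s01 sL e0.
  exists (psi, r) => _; split=> //=; last by exists N.
    have := close_s ord0 0; rewrite lexx ler01 => /(_ isT).
    by rewrite le_min => /andP[_]; apply: le_trans; rewrite lerDr.
  by move=> k x /(close_s k); rewrite le_min => /andP[].
pose s := fix s n := if n is n'.+1 then F (n', s n') else ((fun _ _ => 0), 1) : S.
have adm n : admissible (s n).
  elim: n => [|n IH]; last by have [] := HF (n, s n) IH.
  split=> //=; first by move=> k x _; rewrite lexx ler01.
  by exists 0 => k x y; rewrite subrr normr0 mul0r.
have ref n : refines n (s n) (s n.+1) by exact: HF (n, s n) (adm n).
have /choice[chi chiP] : forall kx : 'I_5 * R, exists l, 0 <= kx.2 <= 1 ->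
    forall n, `|l - (s n).1 kx.1 kx.2| <= (s n).2.
  move=> [k x] /=; have [x01|] := boolP (0 <= x <= 1); last by exists 0.
  have [l hl] := @nested_balls_limit (fun n => (s n).1 k x) (fun n => (s n).2)
    (fun n => let: And3 _ _ h := adm n in ltW h)
    (fun n => let: And4 _ _ h _ := ref n in h k x x01).
  by exists l.
have small e : 0 < e -> exists n, (s n).2 <= e.
  move=> e0; exists (Num.truncn e^-1).+1; have [_ h _ _] := ref (Num.truncn e^-1).
  by apply: le_trans h _; rewrite invf_ple ?posrE ?ltr0n//; apply/ltW/truncnS_gt.
have cl n : close (s n).2 (s n).1 (fun k x => chi (k, x)).
  by move=> k x x01; apply: (chiP (k, x)).
exists (fun k x => chi (k, x)); split.
- move=> k x x01; apply/andP; split; apply/ler_addgt0Pr => e /small[n sn].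
    have [/(_ k x x01) ? _ _] := adm n; have := cl n k x x01; rewrite ler_norml; lra.
  have [/(_ k x x01) ? _ _] := adm n; have := cl n k x x01; rewrite ler_norml; lra.
- move=> e e0; have [n sn] := small (e / 4) (divr_gt0 e0 (ltr0n _ 4)).
  have [_ [L sL] _] := adm n.
  have L1 : 0 < `|L| + 1 by rewrite ltr_wpDl.
  exists (e / 2 / (`|L| + 1)) => [|k x y x01 y01 xy]; first by rewrite !divr_gt0.
  have h : L * `|x - y| <= e / 2.
    rewrite ler_pdivlMr// in xy; apply: le_trans xy; rewrite mulrC ler_wpM2l//.
    by rewrite (le_trans (ler_norm L))// lerDl.
  have := sL k x y; have := cl n k x x01; have := cl n k y y01.
  rewrite !ler_norml; lra.
- move=> n; have [[_ _ r0] _ _ [N [nN sep]]] := ref n.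
  by exists N, (s n.+1).2; split=> //; apply: sep; apply: cl.
Qed.

End Construction.

(** * The map [phi] and the estimate with constant 7/8 *)

Lemma unitIE (R : realType) (x : R) : unitI R x = (0 <= x <= 1).
Proof. by rewrite /unitI /= in_itv. Qed.

Lemma continuous_row (R : realType) (T : topologicalType) n (g : T -> 'rV[R]_n) :
  (forall k, continuous (fun x => g x ord0 k)) -> continuous g.
Proof.
move=> gc x; apply/cvg_ballP => e e0.
have : \forall y \near x, forall k, ball (g x ord0 k) e (g y ord0 k).
  by apply: filter_forall => k; have /cvg_ballP/(_ e e0) := gc k x.
by apply: filterS => y gxy; split=> // i j; rewrite !(ord1 i).
Qed.

Theorem mainTheorem2 (R : realType) :
  exists phi : R -> 'rV[R]_5,
    continuous_I_I5 phi /\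
    forall f : R * R -> R,
      {within unitI2 R, continuous f} -> prekolmogorov (7 / 8) f phi.
Proof.
have [chi [chi01 chiC chiS]] := universal_inner_maps R.
(* [chi] is controlled only on the unit interval; clamping the argument extends it continuously to
   the line. *)
pose phi x : 'rV[R]_5 := \row_k chi k (clamp01 x).
have phiE x k : 0 <= x <= 1 -> phi x ord0 k = chi k x.
  by move=> x01; rewrite mxE clamp01_id.
have cphi : continuous_I_I5 phi.
  split; last by move=> x _ k; rewrite unitIE mxE; apply: chi01; apply: clamp01_bounds.
  apply: continuous_subspaceT; apply: continuous_row => k x.
  apply/cvgrPdist_le => e e0; have [d d0 hd] := chiC e e0.
  near=> y; rewrite !mxE; apply: hd; rewrite ?clamp01_bounds//.
  apply: le_trans (clamp01_lipschitz _ _) _; near: y.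
  exact: cvgr_dist_le.
exists phi; split=> // f cf; split=> // fn0.
have cK : compact (unitI2 R) by apply: compact_setX; apply: segment_compact.
have K00 : unitI2 R (0, 0) by split; rewrite unitIE /= lexx ler01.
pose M := sup_norm (unitI2 R) f.
have fM z : unitI2 R z -> `|f z| <= M by exact: normr_le_sup_norm.
have M0 : 0 < M.
  rewrite lt_neqAle (le_trans _ (fM _ K00))// andbT eq_sym; apply/eqP => M0.
  apply: fn0 => z Kz; apply/eqP; rewrite -normr_le0 -M0; exact: fM.
have [d d0 hd] := compact_within_unif_continuous cK cf (divr_gt0 M0 (ltr0n _ 20)).
(* A scale [N > d^-1] makes [f] vary by less than [M / 20] over steps of length [1 / N]. *)
have [N [r [nN r0 sep]]] := chiS (Num.truncn d^-1).
have Nd : N%:R^-1 < d.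
  rewrite invf_plt ?posrE ?ltr0n//; last by apply: leq_ltn_trans nN.
  by apply: lt_le_trans (truncnS_gt _) _; rewrite ler_nat.
have [h [ch h5 hf]] : exists h : R -> R, [/\ continuous h, forall s, `|h s| <= M / 5 &
    forall x y, 0 <= x <= 1 -> 0 <= y <= 1 ->
      `|f (x, y) - \sum_(k < 5) h (chi k x + Num.sqrt 2 * chi k y)| <= 17 / 20 * M].
  apply: superposition_approx sep _ _ => //; first exact: leq_ltn_trans nN.
    by move=> x y x01 y01; apply: fM; split; rewrite unitIE.
  move=> x y x' y' x01 y01 x'01 y'01 xx yy; apply/ltW/hd.
  - by split; rewrite unitIE.
  - by split; rewrite unitIE.
  - by split; apply: le_lt_trans Nd.
exists h; split.
- exact: continuous_subspaceT.
- apply: (@le_lt_trans _ _ (17 / 20 * M)); last by rewrite -/M; lra.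
  apply: sup_norm_le; first by exists (0, 0).
  move=> [x y] [/=]; rewrite !unitIE => x01 y01.
  by rewrite /S_op /=; under eq_bigr do rewrite !phiE//; apply: hf.
- apply: sup_norm_le; first by exists 0; rewrite /itv03 /= in_itv /= lexx ler0n.
  by move=> s _; apply: le_trans (h5 s) _; rewrite -/M; lra.
Unshelve. all: by end_near. Qed.
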